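(* Every cubic Kolmogorov vector field on $\mathbb{T}^2$ has a rational first integral.
   Context: Fix a real number $a>1$ and let $\mathbb{T}^2=\{(x,y,z)\in\mathbb{R}^3:(x^2+y^2-a^2)^2+z^2-1=0\}$. A triple $\chi=(P,Q,R)$ with $P,Q,R\in\mathbb{R}[x,y,z]$ denotes the polynomial vector field $P\frac{\partial}{\partial x}+Q\frac{\partial}{\partial y}+R\frac{\partial}{\partial z}$ in $\mathbb{R}^3$, acting on polynomials as a derivation; its degree is $\max\{\deg P,\deg Q,\deg R\}$, and it is cubic if its degree is $3$. It is a Kolmogorov vector field if $x\mid P$, $y\mid Q$, $z\mid R$. It is called a vector field on $\mathbb{T}^2$ if $\chi F=KF$ for some $K\in\mathbb{R}[x,y,z]$, where $F=(x^2+y^2-a^2)^2+z^2-1$. A first integral of $\chi$ on an open set $U\subset\mathbb{R}^3$ is a non-constant analytic map $H:U\to\mathbb{R}$ that is constant on all solution curves of $\chi$ contained in $U$ (equivalently $\chi H=0$ on $U$). It is rational if $H$ is a rational function. *)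

(* Defs.v *)
From HB Require Import structures.
From mathcomp Require Import all_boot all_order all_algebra.
From mathcomp Require Import all_classical all_reals all_analysis.
(* The notations of mpoly clash with those of MathComp-Analysis, so they are
   left out; mpoly n R is {mpoly R[n]}, multinom n is 'X_{1..n}, bmultinom n k
   is 'X_{1..n < k}. *)
From mathcomp Require mpoly.
From mathcomp Require Export -(notations) mpoly.

Set Implicit Arguments.
Unset Strict Implicit.
Unset Printing Implicit Defensive.

Import Order.TTheory GRing.Theory Num.Theory.
Import numFieldNormedType.Exports.

Local Open Scope classical_set_scope.
Local Open Scope ring_scope.

Definition mvar (R : realType) (i : 'I_3) : mpoly 3 R := mpolyX R (mnm1 i).

Definition eval_at (R : realType) (p : mpoly 3 R) (x : 'rV[R]_3) : R :=
  meval (fun i => x 0 i) p.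

(* chi stands for the triple (P, Q, R) = (chi 0, chi 1, chi 2); the coordinates
   (x, y, z) have indices 0, 1, 2. *)
Definition vfield (R : realType) := 'I_3 -> mpoly 3 R.

Definition derivation (R : realType) (chi : vfield R) (G : mpoly 3 R) :
  mpoly 3 R := \sum_(i < 3) chi i * mderiv i G.

(* msize is the total degree plus one, and 0 for the zero polynomial. *)
Definition vdegree (R : realType) (chi : vfield R) : nat :=
  (\max_(i < 3) mpoly.msize (chi i)).-1.

Definition cubic (R : realType) (chi : vfield R) : Prop := vdegree chi = 3%N.

Definition kolmogorov (R : realType) (chi : vfield R) : Prop :=
  forall i : 'I_3, exists q : mpoly 3 R, chi i = mvar R i * q.

Definition torus_poly (R : realType) (a : R) : mpoly 3 R :=
  (mvar R 0 ^+ 2 + mvar R 1 ^+ 2 - mpolyC 3 (a ^+ 2)) ^+ 2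
  + mvar R 2 ^+ 2 - 1.

Definition on_torus (R : realType) (a : R) (chi : vfield R) : Prop :=
  exists K : mpoly 3 R, derivation chi (torus_poly a) = K * torus_poly a.

Definition monomial_at (R : realType) (m : multinom 3) (h : 'rV[R]_3) : R :=
  \prod_(i < 3) h 0 i ^+ m i.

(* The power series at x converges absolutely, so that its sum may be taken
   along the partial sums over the monomials of total degree < n. *)
Definition analytic_on (R : realType) (U : set 'rV[R]_3) (H : 'rV[R]_3 -> R) :
  Prop :=
  forall x, U x ->
  exists (c : multinom 3 -> R) (r : R), 0 < r /\
    forall h : 'rV[R]_3, `|h| < r ->
      summable [set: multinom 3] (fun m => (c m * monomial_at m h)%:E) /\
      (fun n : nat => \sum_(m : bmultinom 3 n) c m * monomial_at m h) @ \oo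
        --> H (x + h).

Definition solution_curve (R : realType) (chi : vfield R) (I : set R)
  (gamma : R -> 'rV[R]_3) : Prop :=
  forall t, I t ->
    is_derive t 1 gamma (\row_(i < 3) eval_at (chi i) (gamma t)).

Definition first_integral (R : realType) (chi : vfield R)
  (U : set 'rV[R]_3) (H : 'rV[R]_3 -> R) : Prop :=
  [/\ open U,
      exists x y, [/\ U x, U y & H x <> H y],
      analytic_on U H &
      forall (I : set R) (gamma : R -> 'rV[R]_3),
        open I -> is_interval I -> solution_curve chi I gamma ->
        (forall t, I t -> U (gamma t)) ->
        forall s t, I s -> I t -> H (gamma s) = H (gamma t)].

(* H = f / g on the complement of the zero set of g; this set is nonempty, and
   thus g is nonzero, because H is nonconstant on it. *)
Definition has_rational_first_integral (R : realType) (chi : vfield R) : Prop :=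
  exists f g : mpoly 3 R,
    first_integral chi [set x | eval_at g x != 0]
      (fun x => eval_at f x / eval_at g x).

(* Main.v *)
Require Import Defs.
From HB Require Import structures.
From mathcomp Require Import all_boot all_order all_algebra.
From mathcomp Require Import all_classical all_reals all_analysis.
From mathcomp Require Import zify ring lra.
From mathcomp.multinomials Require Import ssrcomplements.

(* Put s = x^2 + y^2 and chi = (x p, y q, z r).  Comparing homogeneous parts in
   chi F = K F forces K to be quadratic and 2 chi s = K s.  Hence
   chi (s^2) = K s^2, so F and s^2 have the same cofactor and F / s^2 is a
   rational first integral. *)

Set Implicit Arguments.
Unset Strict Implicit.
Unset Printing Implicit Defensive.

Import Order.TTheory GRing.Theory Num.Theory.
Import numFieldNormedType.Exports.

Local Open Scope classical_set_scope.
Local Open Scope ring_scope.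

(** * The cofactor of a cubic Kolmogorov field *)

(** The homogeneous part of degree d of [p], evaluated at [v], becomes the coefficient of ['X^d].
    Comparing homogeneous parts thus reduces to comparing coefficients of univariate polynomials. *)
Definition line_restrict (R : realType) (n : nat) (v : 'I_n -> R) (p : mpoly n R) :
  {poly R} := mmap (@polyC R) (fun i => v i *: 'X) p.

HB.instance Definition _ (R : realType) (n : nat) (v : 'I_n -> R) :=
  GRing.RMorphism.copy (line_restrict v) (mmap (@polyC R) (fun i => v i *: 'X)).

Lemma line_restrictE (R : realType) (n : nat) (v : 'I_n -> R) (p : mpoly n R) :
  line_restrict v p =
  \sum_(m <- msupp p) (mcoeff m p * \prod_i v i ^+ m i) *: 'X^(mdeg m).
Proof.
apply: eq_bigr => m _; rewrite mul_polyC -scalerA; congr (_ *: _).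
by rewrite /mmap1 mdegE -prodrXr -scaler_prod; apply: eq_bigr => i _; rewrite exprZn.
Qed.

Lemma size_line_restrict (R : realType) (n : nat) (v : 'I_n -> R) (p : mpoly n R) :
  (size (line_restrict v p) <= mmeasure (@mdeg n) p)%N.
Proof.
rewrite line_restrictE big_seq; apply: (leq_trans (size_sum _ _ _)).
apply/bigmax_leqP_seq => m _ mp.
by rewrite (leq_trans (size_scale_leq _ _))// size_polyXn mmeasure_mnm_lt.
Qed.

Lemma horner_line_restrict (R : realType) (n : nat) (v : 'I_n -> R) (p : mpoly n R)
  (t : R) : (line_restrict v p).[t] = meval (fun i => v i * t) p.
Proof.
rewrite line_restrictE horner_sum mevalE; apply: eq_bigr => m _.
rewrite hornerZ hornerXn -mulrA; congr (_ * _).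
by rewrite mdegE -prodrXr -big_split; apply: eq_bigr => i _; rewrite exprMn.
Qed.


Lemma poly_size3 (R : realType) (p : {poly R}) : (size p <= 3)%N ->
  p = (p`_0)%:P + (p`_1)%:P * 'X + (p`_2)%:P * 'X^2.
Proof.
move=> sp; apply/polyP => i; rewrite !coefD !coefCM coefC coefX coefXn.
case: i => [|[|[|i]]]; rewrite /= ?(mulr0, mulr1, addr0, add0r)//.
by rewrite nth_default// (leq_trans sp).
Qed.

Lemma poly_size7_eq0 (R : realType) (c0 c1 c2 c3 c4 c5 c6 : R) :
  c0%:P + c1%:P * 'X + c2%:P * 'X^2 + c3%:P * 'X^3 + c4%:P * 'X^4 +
    c5%:P * 'X^5 + c6%:P * 'X^6 = 0 ->
  [/\ c0 = 0, c1 = 0, c2 = 0, c3 = 0 & [/\ c4 = 0, c5 = 0 & c6 = 0]].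
Proof.
move=> h; have c i := congr1 (fun p : {poly R} => p`_i) h.
by do !split; [have := c 0|have := c 1|have := c 2|have := c 3|have := c 4
  |have := c 5|have := c 6]; rewrite !coefD !coefCM coefC ?coefX ?coefXn coef0 /=
  ?(mulr0, mulr1, addr0, add0r).
Qed.

Lemma size_torus_line (R : realType) (s w A : R) : s != 0 ->
  size ((s%:P * 'X^2 - A%:P) ^+ 2 + w%:P * 'X^2 - 1 : {poly R}) = 5%N.
Proof.
move=> s0.
have -> : (s%:P * 'X^2 - A%:P) ^+ 2 + w%:P * 'X^2 - 1 =
  (s ^+ 2) *: 'X^4 + ((w - 2 * A * s) *: 'X^2 + (A ^+ 2 - 1)%:P) :> {poly R}.
  by rewrite -!mul_polyC; ring.
rewrite size_polyDl size_scale ?expf_neq0// size_polyXn//.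
rewrite (leq_ltn_trans (size_polyD _ _))// gtn_max.
rewrite (leq_ltn_trans (size_scale_leq _ _)) ?size_polyXn//.
by rewrite (leq_ltn_trans (size_polyC_leq1 _)).
Qed.

(* The restriction of chi F = K F to a line t v, where s and w are the values of
   x^2 + y^2 and z^2 at v, A = a^2, and m and r are the restrictions of
   x^2 p + y^2 q (with x, y taken at v) and of r.  The first conclusion, used at
   v = (1,0,0) and (0,1,0), gives p(0) = q(0) = 0. *)
Lemma torus_cofactor_line (R : realType) (s w A : R) (m r K : {poly R}) :
  s != 0 -> A ^+ 2 != 1 -> (size m <= 3)%N -> (size r <= 3)%N ->
  4 * (s%:P * 'X^2 - A%:P) * ('X^2 * m) + 2 * (w%:P * 'X^2) * r
    = K * ((s%:P * 'X^2 - A%:P) ^+ 2 + w%:P * 'X^2 - 1) ->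
  (w = 0 -> m.[0] = 0) /\ (m.[0] = 0 -> 4 * m.[1] = K.[1] * s).
Proof.
move=> s0 A1 sm sr E.
(* The left side of [E] has degree at most 6 and the factor of [K] has degree exactly 4, as
   [s != 0]; hence [K] is at most quadratic. *)
have sK : (size K <= 3)%N.
  have [->|K0] := eqVneq K 0; first by rewrite size_poly0.
  have : (size (K * ((s%:P * 'X^2 - A%:P) ^+ 2 + w%:P * 'X^2 - 1))%R <= 7)%N.
    rewrite -E (leq_trans (size_polyD _ _))// geq_max; apply/andP; split.
      have h1 : (size (4 * (s%:P * 'X^2 - A%:P) : {poly R})%R <= 3)%N.
        rewrite -[4]/(4%:R) -polyC_natr mul_polyC.
        rewrite (leq_trans (size_scale_leq _ _))//.
        rewrite (leq_trans (size_polyD _ _))// geq_max size_polyN.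
        rewrite mul_polyC (leq_trans (size_scale_leq _ _)) ?size_polyXn//=.
        by rewrite (leq_trans (size_polyC_leq1 _)).
      have h2 : (size ('X^2 * m)%R <= 5)%N.
        rewrite (leq_trans (size_polyMleq _ _))// size_polyXn.
        by move: sm; lia.
      rewrite (leq_trans (size_polyMleq _ _))//.
      by move: h1 h2; lia.
    have h1 : (size (2 * (w%:P * 'X^2) : {poly R})%R <= 3)%N.
      rewrite -[2]/(2%:R) -polyC_natr !mul_polyC.
      rewrite (leq_trans (size_scale_leq _ _))//.
      by rewrite (leq_trans (size_scale_leq _ _)) ?size_polyXn.
    rewrite (leq_trans (size_polyMleq _ _))//.
    by move: h1 sr; lia.
  have D5 := size_torus_line w A s0.
  by rewrite size_mul ?D5//; [move: (size K) => k; lia | rewrite -size_poly_eq0 D5].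
move: E; rewrite (poly_size3 sm) (poly_size3 sr) (poly_size3 sK).
move: m`_0 m`_1 m`_2 r`_0 r`_1 r`_2 K`_0 K`_1 K`_2 => m0 m1 m2 r0 r1 r2 k0 k1 k2 E.
(* The left side of [E] minus its right side, collected by degree. Degrees 0 and 1 give
   [k0 = k1 = 0] because [A ^+ 2 != 1]; degrees 5 and 6 then give [m1 = 0] and [4 * m2 = k2 * s]. *)
have /poly_size7_eq0[] :
  (- k0 * (A ^+ 2 - 1))%:P + (- k1 * (A ^+ 2 - 1))%:P * 'X
  + (2 * w * r0 - 4 * A * m0 - k2 * (A ^+ 2 - 1) - k0 * (w - 2 * A * s))%:P * 'X^2
  + (2 * w * r1 - 4 * A * m1 - k1 * (w - 2 * A * s))%:P * 'X^3
  + (4 * s * m0 - 4 * A * m2 + 2 * w * r2 - k0 * s ^+ 2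
      - k2 * (w - 2 * A * s))%:P * 'X^4
  + (4 * s * m1 - k1 * s ^+ 2)%:P * 'X^5
  + (4 * s * m2 - k2 * s ^+ 2)%:P * 'X^6 = 0 :> {poly R}.
  move/eqP : E; rewrite -subr_eq0 => /eqP E; rewrite -[RHS]E.
  by ring.
move=> e0 e1 e2 _ [e4 e5 e6]; rewrite !hornerE.
have A10 : A ^+ 2 - 1 != 0 by rewrite subr_eq0.
have k00 : k0 = 0 by apply: (mulIf A10); rewrite mul0r; move: e0; lra.
have k10 : k1 = 0 by apply: (mulIf A10); rewrite mul0r; move: e1; lra.
have m10 : m1 = 0.
  by apply: (mulfI s0); rewrite mulr0; move: e5; rewrite k10; lra.
have m2E : 4 * m2 = k2 * s by apply: (mulfI s0); move: e6; lra.
split => [w0|m00].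
  (* For [w = 0], degree 4 reads [4 * m0 = - (A * k2)]. Inserted into degree 2, this cancels the
     terms in [A ^+ 2] and leaves [k2 = 0]. *)
  move: e2 e4; rewrite w0 k00 => e2 e4.
  have m0E : 4 * m0 = - (A * k2).
    apply: (mulfI s0); move: e4; rewrite -[4 * A * m2]mulrAC m2E; lra.
  have k20 : k2 = 0.
    have : A * (4 * m0) + A * (A * k2) = 0 by rewrite m0E; ring.
    by move: e2; lra.
  by move: m0E; rewrite k20 /= ?(mulr0, mulr1, addr0); lra.
by rewrite k00 k10 m10; move: m00 m2E; rewrite !hornerE /= ?(mulr0, mulr1, addr0); lra.
Qed.

Lemma derivationD (R : realType) (chi : vfield R) (p q : mpoly 3 R) :
  derivation chi (p + q) = derivation chi p + derivation chi q.
Proof.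
by rewrite -big_split; apply: eq_bigr => i _; rewrite mderivD mulrDr.
Qed.

Lemma derivationM (R : realType) (chi : vfield R) (p q : mpoly 3 R) :
  derivation chi (p * q) = derivation chi p * q + p * derivation chi q.
Proof.
rewrite mulr_suml mulr_sumr -big_split; apply: eq_bigr => i _ /=.
by rewrite mderivM; ring.
Qed.

Lemma derivationC (R : realType) (chi : vfield R) (c : R) :
  derivation chi (mpolyC 3 c) = 0.
Proof. by apply: big1 => i _; rewrite mderivC mulr0. Qed.

Lemma derivationX2 (R : realType) (chi : vfield R) (p : mpoly 3 R) :
  derivation chi (p ^+ 2) = 2 * p * derivation chi p.
Proof. by rewrite expr2 derivationM; ring. Qed.

Lemma derivation_mvar (R : realType) (chi : vfield R) (i : 'I_3) :
  derivation chi (mvar R i) = chi i.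
Proof.
rewrite /derivation (bigD1 i)//= big1 => [|j ji].
  rewrite addr0 mderivX mnm1E eqxx scale1r.
  have -> : mnm_sub (mnm1 i) (mnm1 i) = @mnm0 3.
    by apply/mnmP => k; rewrite mnmBE mnm0E subnn.
  by rewrite mpolyX0 mulr1.
by rewrite mderivX mnm1E eq_sym (negbTE ji) scale0r mulr0.
Qed.

(** The squared distance to the z-axis, called s in the overview; it is nonzero exactly off that
    axis. *)
Definition radius_poly (R : realType) : mpoly 3 R := mvar R 0 ^+ 2 + mvar R 1 ^+ 2.

Lemma derivation_radius_poly (R : realType) (chi : vfield R) :
  derivation chi (radius_poly R) = 2 * (mvar R 0 * chi 0 + mvar R 1 * chi 1).
Proof. by rewrite derivationD !expr2 !derivationM !derivation_mvar; ring. Qed.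

(** The variables x and y enter F only through s, so by the chain rule the action of [chi] on s and
    z suffices. *)
Lemma derivation_torus_poly (R : realType) (a : R) (chi : vfield R) :
  derivation chi (torus_poly a) =
  2 * (radius_poly R - mpolyC 3 (a ^+ 2)) * derivation chi (radius_poly R)
  + 2 * mvar R 2 * chi 2.
Proof.
rewrite /torus_poly -/(radius_poly R) derivationD [in LHS]derivationD !derivationX2.
have -> : derivation chi (- 1) = 0 by rewrite -mpolyC1 -mpolyCN derivationC.
rewrite derivationD -mpolyCN derivationC derivation_mvar; ring.
Qed.

Lemma msize_kolmogorov_factor (R : realType) (chi : vfield R) (i : 'I_3)
  (q : mpoly 3 R) : cubic chi -> chi i = mvar R i * q ->
  (mmeasure (@mdeg 3) q <= 3)%N.
Proof.
move=> hc hq; have [->|q0] := eqVneq q 0; first by rewrite mmeasure0.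
have le4 : (mmeasure (@mdeg 3) (chi i) <= 4)%N.
  have := leq_bigmax (F := fun j => mmeasure (@mdeg 3) (chi j)) i.
  (* [vdegree] is a predecessor: the maximum must be seen to be positive before [hc] makes it 4. *)
  rewrite -[bigop _ _ _]prednK; first by rewrite [_.-1]hc.
  by move: hc; rewrite /cubic /vdegree; case: (bigop _ _ _).
have X0 : mvar R i != 0 by rewrite -msize_poly_eq0 msizeX.
by move: le4; rewrite hq msizeM// msizeX mdeg1.
Qed.

Lemma line_restrict_mvar (R : realType) (v : 'I_3 -> R) (i : 'I_3) :
  line_restrict v (mvar R i) = v i *: 'X.
Proof. by rewrite /line_restrict mmapX mmap1U. Qed.

(** The value at [v] is the value at t = 1 on the line through 0 and [v], where
    [torus_cofactor_line] applies. A pointwise identity off the z-axis is enough, since the first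
    integral is defined only there. *)
Lemma kolmogorov_cofactor (R : realType) (a : R) (chi : vfield R)
  (K : mpoly 3 R) (v : 'I_3 -> R) :
  1 < a -> cubic chi -> kolmogorov chi ->
  derivation chi (torus_poly a) = K * torus_poly a ->
  meval v (radius_poly R) != 0 ->
  2 * meval v (derivation chi (radius_poly R)) =
  meval v K * meval v (radius_poly R).
Proof.
move=> a1 hcub hkol hK.
have [p hp] := hkol 0; have [q hq] := hkol 1; have [r hr] := hkol 2.
have sp := msize_kolmogorov_factor hcub hp.
have sq := msize_kolmogorov_factor hcub hq.
have sr := msize_kolmogorov_factor hcub hr.
have sv (u : 'I_3 -> R) : meval u (radius_poly R) = u 0 ^+ 2 + u 1 ^+ 2.
  by rewrite mevalD !rmorphXn /= !mevalXU.
(* On the line through [u], [derivation chi (radius_poly R)] becomes [2 * ('X^2 * m u)]. *)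
pose m (u : 'I_3 -> R) : {poly R} :=
  u 0 ^+ 2 *: line_restrict u p + u 1 ^+ 2 *: line_restrict u q.
have along (u : 'I_3 -> R) : u 0 ^+ 2 + u 1 ^+ 2 != 0 ->
  (u 2 = 0 -> (m u).[0] = 0) /\
  ((m u).[0] = 0 -> 4 * (m u).[1] = (line_restrict u K).[1] * (u 0 ^+ 2 + u 1 ^+ 2)).
  move=> u0.
  (* The constant term of F is a^4 - 1, nonzero because a > 1. *)
  have a4 : (a ^+ 2) ^+ 2 != 1 by rewrite gt_eqF// !exprn_egt1.
  have sm : (size (m u) <= 3)%N.
    rewrite (leq_trans (size_polyD _ _))// geq_max.
    by rewrite !(leq_trans (size_scale_leq _ _))// (leq_trans (size_line_restrict _ _)).
  have slr := leq_trans (size_line_restrict u r) sr.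
  have := torus_cofactor_line (w := u 2 ^+ 2) (K := line_restrict u K) u0 a4 sm slr.
  case=> [|h1 h2].
    have := congr1 (line_restrict u) hK.
    rewrite derivation_torus_poly derivation_radius_poly hp hq hr /radius_poly /torus_poly.
    rewrite !(rmorphM, rmorphD, rmorphB, rmorphXn, rmorphN, rmorph1, rmorph_nat) /=.
    rewrite !line_restrict_mvar /line_restrict mmapC -/(line_restrict u) /m.
    rewrite -!mul_polyC => E.
    apply: etrans (etrans E _); ring.
  by split=> // u2; apply: h1; rewrite u2 expr0n.
have m0E u : (m u).[0] =
    u 0 ^+ 2 * meval (fun=> 0) p + u 1 ^+ 2 * meval (fun=> 0) q.
  rewrite hornerD !hornerZ !horner_line_restrict.
  by rewrite !(@meval_eq _ _ (fun i => u i * 0) (fun=> 0))// => i; rewrite mulr0.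
have p0 : meval (fun=> 0) p = 0.
  case: (along (fun i => (i == 0)%:R)) => [|/[swap] _].
    by rewrite /= expr0n expr1n addr0 oner_neq0.
  by rewrite m0E /= expr1n expr0n mul1r mul0r addr0; exact.
have q0 : meval (fun=> 0) q = 0.
  case: (along (fun i => (i == 1)%:R)) => [|/[swap] _].
    by rewrite /= expr0n expr1n add0r oner_neq0.
  by rewrite m0E /= expr1n expr0n mul1r mul0r add0r; exact.
(* With p(0) = q(0) = 0, [m v] vanishes at 0, so the second half of [along] applies in the direction
   [v]. *)
rewrite sv => v0; have [_] := along v v0.
rewrite m0E p0 q0 !mulr0 addr0 => /(_ erefl).
have ev f : (line_restrict v f).[1] = meval v f.
  by rewrite horner_line_restrict; apply: meval_eq => i; rewrite mulr1.
rewrite hornerD !hornerZ !ev => <-.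
rewrite derivation_radius_poly hp hq !(mevalM, mevalD, mevalXU); ring.
Qed.

(** * Derivatives along solution curves *)

(** Constants and variables generate the polynomial ring; differentiation along curves and
    continuity then follow from the sum and product rules. *)
Lemma mpoly_ring_ind (R : realType) (n : nat) (P : mpoly n R -> Prop) :
  (forall c, P (mpolyC n c)) -> (forall i, P (mpolyX R (mnm1 i))) ->
  (forall p q, P p -> P q -> P (p + q)) ->
  (forall p q, P p -> P q -> P (p * q)) -> forall p, P p.
Proof.
move=> PC PV PD PM p.
have PX m : P (mpolyX R m).
  rewrite mpolyXE_id; apply: (big_ind P) => [|q r|i _].
  - by rewrite -mpolyC1.
  - exact: PM.
  - elim: (m i) => [|k IH]; first by rewrite expr0 -mpolyC1.
    by rewrite exprS; exact: PM.
rewrite (mpolyE p); apply: (big_ind P) => [|q r|m _].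
- by rewrite -mpolyC0.
- exact: PD.
- by rewrite -mul_mpolyC; exact: PM.
Qed.

Lemma is_derive_coord (R : realType) (n : nat) (gamma : R -> 'rV[R]_n) (t : R)
  (d : 'rV[R]_n) (i : 'I_n) :
  is_derive t 1 gamma d -> is_derive t 1 (fun u => gamma u 0 i) (d 0 i).
Proof.
move=> [dg <-]; have /derivable_mxP dgi := dg.
by split; [exact: dgi | rewrite derive_mx// mxE].
Qed.

Lemma is_derive_eval_at (R : realType) (chi : vfield R) (gamma : R -> 'rV[R]_3)
  (t : R) (p : mpoly 3 R) :
  is_derive t 1 gamma (\row_(i < 3) eval_at (chi i) (gamma t)) ->
  is_derive t 1 (fun u => eval_at p (gamma u)) (eval_at (derivation chi p) (gamma t)).
Proof.
move=> dg; elim/mpoly_ring_ind : p => [c|i|q r|q r].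
- rewrite derivationC /eval_at meval0.
  under [X in is_derive _ _ X _]eq_fun do rewrite mevalC.
  exact: is_derive_cst.
- rewrite [derivation _ _]derivation_mvar /eval_at.
  under [X in is_derive _ _ X _]eq_fun do rewrite mevalXU.
  by apply: is_derive_eq (is_derive_coord i dg) _; rewrite mxE.
- rewrite derivationD /eval_at mevalD => hq hr.
  under [X in is_derive _ _ X _]eq_fun do rewrite mevalD.
  exact: is_deriveD.
- rewrite derivationM /eval_at mevalD !mevalM => hq hr.
  under [X in is_derive _ _ X _]eq_fun do rewrite mevalM.
  apply: is_derive_eq (is_deriveM hq hr) _.
  by rewrite /= /GRing.scale/=; ring.
Qed.

Lemma is_derive0_constant (R : realType) (I : set R) (f : R -> R) :
  is_interval I -> (forall t, I t -> is_derive t 1 f 0) ->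
  forall s t, I s -> I t -> f s = f t.
Proof.
move=> itvI df s t; wlog st : s t / s <= t => [hw Is It|Is It].
  by have [/hw|/ltW/hw] := leP s t; [apply|move=> h; apply/esym/h].
have inI u : u \in `[s, t] -> I u.
  by rewrite in_itv/= => /andP[su ut]; apply: itvI Is It _ _; rewrite su.
have [||c _ /eqP] := MVT_segment (f := f) (df := fun=> 0) st.
- by move=> u /subset_itv_oo_cc/inI/df.
- apply: continuous_in_subspaceT => u; rewrite inE /= => /inI /df[du _].
  exact/differentiable_continuous/derivable1_diffP.
- by rewrite mul0r subr_eq0 eq_sym => /eqP.
Qed.

(** With a common cofactor [K], the derivative of f / g along a curve is (K f g - f K g) / g^2 =
    0. *)
Lemma quotient_constant_on_curves (R : realType) (chi : vfield R) (f g K : mpoly 3 R)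
  (I : set R) (gamma : R -> 'rV[R]_3) :
  (forall x, eval_at g x != 0 ->
     eval_at (derivation chi f) x = eval_at K x * eval_at f x /\
     eval_at (derivation chi g) x = eval_at K x * eval_at g x) ->
  is_interval I -> solution_curve chi I gamma ->
  (forall t, I t -> eval_at g (gamma t) != 0) ->
  forall s t, I s -> I t ->
    eval_at f (gamma s) / eval_at g (gamma s) =
    eval_at f (gamma t) / eval_at g (gamma t).
Proof.
move=> cof itvI sol g0; apply: (is_derive0_constant itvI) => t It.
have df := is_derive_eval_at f (sol t It).
have dg := is_derive_eval_at g (sol t It).
have [ef eg] := cof _ (g0 _ It).
have := is_deriveM df (is_deriveV (g0 _ It) dg).
move=> /is_derive_eq; apply.
rewrite /= ef eg /GRing.scale /=; field.
exact: g0.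
Qed.

(** * Power series of a quotient of polynomials *)

Section WeightedNorm.
Variables (R : realType) (n : nat).
Implicit Types (p q : mpoly n R) (r : R) (m : multinom n).

(** The l^1 norm of the coefficients with weight r^d in degree d. It is submultiplicative and bounds
    [p] on the polydisc of radius [r], so it controls absolute convergence. *)
Definition mnorm r p := \sum_(m <- msupp p) `|mcoeff m p| * r ^+ mdeg m.

(** Passes between the index type of the partial sums in [analytic_on] and the support of a
    polynomial. *)
Lemma sum_bmultinom_msupp p k (F : multinom n -> R) :
  (forall m, mcoeff m p = 0 -> F m = 0) ->
  \sum_(m : bmultinom n k) F m = \sum_(m <- msupp p | (mdeg m < k)%N) F m.
Proof.
move=> F0; rewrite (big_mksub_cond (bmultinom n k)) ?msupp_uniq//.
rewrite [RHS]big_mkcond /=; apply: eq_bigr => m _.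
by rewrite bmdeg /= mcoeff_msupp; case: eqP => // /F0.
Qed.

Lemma mnormE p r k : (mmeasure (@mdeg n) p <= k)%N ->
  mnorm r p = \sum_(m : bmultinom n k) `|mcoeff m p| * r ^+ mdeg m.
Proof.
move=> pk; pose F m := `|mcoeff m p| * r ^+ mdeg m.
rewrite (@sum_bmultinom_msupp p k F) => [|m]; last first.
  by rewrite /F => ->; rewrite normr0 mul0r.
rewrite big_seq_cond [LHS]big_seq; apply: eq_bigl => m.
have [/= mp|//] := boolP (m \in msupp p).
by rewrite (leq_trans (mmeasure_mnm_lt _ mp)).
Qed.

Lemma mnorm_ge0 r p : 0 <= r -> 0 <= mnorm r p.
Proof. by move=> r0; apply: sumr_ge0 => m _; rewrite mulr_ge0 ?exprn_ge0. Qed.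

Lemma mnormD r p q : 0 <= r -> mnorm r (p + q) <= mnorm r p + mnorm r q.
Proof.
move=> r0; pose k := maxn (mmeasure (@mdeg n) p) (mmeasure (@mdeg n) q).
rewrite (@mnormE (p + q) _ k) ?(@mnormE p _ k) ?(@mnormE q _ k) ?leq_maxl ?leq_maxr//.
  rewrite -big_split; apply: ler_sum => m _ /=.
  by rewrite -mulrDl ler_wpM2r ?exprn_ge0// mcoeffD ler_normD.
exact: mmeasureD_le.
Qed.

Lemma mnorm0 r : mnorm r 0 = 0.
Proof. by rewrite /mnorm -mpolyC0 msupp0 big_nil. Qed.

Lemma mnorm_sum r (I : Type) (s : seq I) (P : pred I) (F : I -> mpoly n R) : 0 <= r ->
  mnorm r (\sum_(i <- s | P i) F i) <= \sum_(i <- s | P i) mnorm r (F i).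
Proof.
move=> r0; elim/big_ind2 : _ => [|p a q b pa qb|//]; first by rewrite mnorm0.
by rewrite (le_trans (mnormD _ _ r0))// lerD.
Qed.

Lemma mnormZ r c p : mnorm r (c *: p) = `|c| * mnorm r p.
Proof.
pose k := mmeasure (@mdeg n) p.
rewrite (@mnormE (c *: p) _ k) ?mmeasureZ_le// (@mnormE p _ k)// mulr_sumr.
by apply: eq_bigr => m _; rewrite mcoeffZ normrM mulrA.
Qed.

Lemma mnormX r m : mnorm r (mpolyX R m) = r ^+ mdeg m.
Proof. by rewrite /mnorm msuppX big_seq1 mcoeffX eqxx normr1 mul1r. Qed.

Lemma mnorm1 r : mnorm r 1 = 1.
Proof. by rewrite -(mpolyX0 n R) mnormX mdeg0 expr0. Qed.

Lemma mnormM r p q : 0 <= r -> mnorm r (p * q) <= mnorm r p * mnorm r q.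
Proof.
move=> r0; rewrite {1}(mpolyE p) mulr_suml (le_trans (mnorm_sum _ _ _ r0))//.
rewrite mulr_suml ler_sum// => m _.
rewrite {1}(mpolyE q) mulr_sumr (le_trans (mnorm_sum _ _ _ r0))//.
rewrite mulr_sumr ler_sum// => m' _.
rewrite -scalerAl -scalerAr -mpolyXD !mnormZ mnormX mdegD exprD.
by rewrite mulrACA mulrA.
Qed.

Lemma mnorm_exp r p k : 0 <= r -> mnorm r (p ^+ k) <= mnorm r p ^+ k.
Proof.
move=> r0; elim: k => [|k IH]; first by rewrite !expr0 mnorm1.
by rewrite !exprS (le_trans (mnormM _ _ r0))// ler_wpM2l ?mnorm_ge0.
Qed.

Lemma norm_prod_le (v : 'I_n -> R) r m : (forall i, `|v i| <= r) ->
  `|\prod_i v i ^+ m i| <= r ^+ mdeg m.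
Proof.
move=> vr; rewrite normr_prod mdegE -prodrXr ler_prod// => i _.
by rewrite normr_ge0 normrX lerXn2r ?nnegrE// (le_trans _ (vr i)).
Qed.

Lemma norm_meval_le (v : 'I_n -> R) r p : (forall i, `|v i| <= r) ->
  `|meval v p| <= mnorm r p.
Proof.
move=> vr; rewrite mevalE (le_trans (ler_norm_sum _ _ _))// ler_sum// => m _.
by rewrite normrM ler_wpM2l// norm_prod_le.
Qed.

Lemma sum_mcoeff_le_mnorm r p (s : seq (multinom n)) : 0 <= r -> uniq s ->
  \sum_(m <- s) `|mcoeff m p| * r ^+ mdeg m <= mnorm r p.
Proof.
move=> r0 us; rewrite (bigID (mem (msupp p))) /= [X in _ + X]big1 ?addr0; last first.
  by move=> m /memN_msupp_eq0 ->; rewrite normr0 mul0r.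
rewrite /mnorm [leRHS](bigID (mem s)) /=.
rewrite -[leLHS]big_filter -[X in _ <= X + _]big_filter.
rewrite (perm_big [seq m <- msupp p | m \in s]) ?lerDl ?sumr_ge0//= => [m _|].
  by rewrite mulr_ge0 ?exprn_ge0.
apply: uniq_perm; rewrite ?filter_uniq ?msupp_uniq// => m.
by rewrite !mem_filter andbC.
Qed.

(** Every monomial of [p] has degree at least 1, and r^d <= r for such d when r <= 1. Shrinking [r]
    thus makes the norm as small as desired. *)
Lemma mnorm_small r p : 0 <= r <= 1 -> mcoeff mnm0 p = 0 ->
  mnorm r p <= r * mnorm 1 p.
Proof.
move=> /andP[r0 r1] p0; rewrite mulr_sumr ler_sum// => m _.
rewrite expr1n mulr1 mulrC; have [->|m0] := eqVneq m mnm0.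
  by rewrite p0 normr0 !mulr0.
rewrite ler_wpM2r//; case: (mdeg m) (mdeg_eq0 m) => [|k _].
  by rewrite eqxx (negbTE m0).
by rewrite exprS ler_piMr// exprn_ile1.
Qed.

(** Each factor [q] raises the order of vanishing at 0 by at least one. *)
Lemma mcoeffM_exp_eq0 p q k m : mcoeff mnm0 q = 0 -> (mdeg m < k)%N ->
  mcoeff m (p * q ^+ k) = 0.
Proof.
move=> q0; elim: k m => // k IH m mk.
rewrite exprSr mulrA mcoeffM big1 // => -[m1 m2] /= /eqP mE.
have [->|m20] := eqVneq (bmnm m2) mnm0; first by rewrite q0 mulr0.
have := congr1 (@mdeg n) mE; rewrite mdegD => mdE.
by rewrite IH ?mul0r//; move: m20 mk mdE; rewrite -mdeg_eq0; lia.
Qed.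

Lemma meval0_mcoeff0 p : meval (fun=> 0) p = mcoeff mnm0 p.
Proof.
rewrite [in RHS](mpolyE p) raddf_sum /= mevalE; apply: eq_bigr => m _.
rewrite mcoeffZ mcoeffX; congr (_ * _).
rewrite prodrXr -mdegE expr0n mdeg_eq0; by case: eqVneq.
Qed.

End WeightedNorm.

Section QuotientSeries.
Variables (R : realType) (n : nat) (f g : mpoly n R).
Hypothesis g0 : mcoeff mnm0 g != 0.

Let b := mcoeff mnm0 g.

(* g = b (1 - u) with u(0) = 0, so that f / g = b^-1 f (1 + u + u^2 + ...). *)
Definition geometric_defect : mpoly n R := 1 - b^-1 *: g.
Local Notation u := geometric_defect.

Definition quotient_approx (N : nat) : mpoly n R :=
  b^-1 *: (f * \sum_(k < N) u ^+ k).

(* The coefficient at m is stationary in N for N > mdeg m, since u^k has no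
   terms of degree less than k. *)
Definition quotient_coef (m : multinom n) : R :=
  mcoeff m (quotient_approx (mdeg m).+1).

Let u00 : mcoeff mnm0 u = 0.
Proof. by rewrite mcoeffB mcoeffZ mcoeff1 eqxx mulVf ?subrr. Qed.

Lemma mcoeff_quotient_approx (N : nat) (m : multinom n) :
  (mdeg m < N)%N -> mcoeff m (quotient_approx N) = quotient_coef m.
Proof.
elim: N => // N IH; rewrite ltnS leq_eqVlt => /predU1P[<-//|mN].
rewrite -(IH mN) /quotient_approx big_ord_recr /= mulrDr scalerDr mcoeffD.
by rewrite [X in _ + X]mcoeffZ mcoeffM_exp_eq0// mulr0 addr0.
Qed.

(** The geometric sum telescopes, as 1 - u = g / b; the relative error is u^N. *)
Lemma quotient_approx_eval (N : nat) (v : 'I_n -> R) : meval v g != 0 ->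
  meval v (quotient_approx N) = meval v f / meval v g * (1 - meval v u ^+ N).
Proof.
move=> gv; have uE : meval v u = 1 - b^-1 * meval v g.
  by rewrite mevalB meval1 mevalZ.
rewrite mevalZ mevalM rmorph_sum /=.
rewrite (eq_bigr (fun k : 'I_N => meval v u ^+ k)) => [|k _]; last exact: rmorphXn.
have := subrX1 (meval v u) N.
move: (\sum_(k < N) meval v u ^+ k) => S.
have -> : meval v u - 1 = - (b^-1 * meval v g) by rewrite uE; ring.
move=> uS; rewrite -opprB uS; field; exact/andP.
Qed.

Lemma quotient_radius :
  exists2 r : R, 0 < r <= 1 & mnorm r u <= 2^-1.
Proof.
pose M := mnorm 1 u; have M0 : 0 <= M by exact: mnorm_ge0.
(* By [mnorm_small] the norm at radius r is at most r M. The 1 in the denominator keeps it positive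
   when M = 0 and gives r <= 1. *)
exists (2^-1 / (1 + M)).
  rewrite divr_gt0 ?ltr_wpDr//= ler_pdivrMr ?ltr_wpDr// mul1r; lra.
rewrite (le_trans (mnorm_small _ u00))//.
  rewrite divr_ge0 ?addr_ge0//= ler_pdivrMr ?ltr_wpDr// mul1r; lra.
by rewrite -/M mulrAC ler_pdivrMr ?ltr_wpDr//; lra.
Qed.

(** The bound is uniform in [N], because the geometric series of ratio 1/2 sums to at most 2. *)
Lemma mnorm_quotient_approx (r : R) (N : nat) : 0 <= r -> mnorm r u <= 2^-1 ->
  mnorm r (quotient_approx N) <= `|b^-1| * (mnorm r f * 2).
Proof.
move=> r0 ur; rewrite mnormZ ler_wpM2l// (le_trans (mnormM _ _ r0))//.
rewrite ler_wpM2l ?mnorm_ge0// (le_trans (mnorm_sum _ _ _ r0))//.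
have h : \sum_(k < N) (2^-1 : R) ^+ k <= 2.
  have := subrX1 (2^-1 : R) N; have := @exprn_ge0 R N 2^-1.
  by rewrite invr_ge0 ler0n => /(_ isT); lra.
apply: le_trans h; apply: ler_sum => k _.
by rewrite (le_trans (mnorm_exp _ _ r0))// lerXn2r ?nnegrE ?mnorm_ge0.
Qed.

(** Below degree [N] the approximant and the series have the same coefficients. The remaining terms
    have degree at least [N], so halving the radius gains a factor 2^-N. *)
Lemma quotient_tail (r : R) (N : nat) (v : 'I_n -> R) :
  0 < r -> (forall i, `|v i| <= r / 2) ->
  `|meval v (quotient_approx N) -
    \sum_(m : bmultinom n N) quotient_coef m * \prod_i v i ^+ m i|
  <= mnorm r (quotient_approx N) * 2^-1 ^+ N.
Proof.
move=> r0 vr; set p := quotient_approx N.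
have -> : \sum_(m : bmultinom n N) quotient_coef m * \prod_i v i ^+ m i =
    \sum_(m <- msupp p | (mdeg m < N)%N) mcoeff m p * \prod_i v i ^+ m i.
  rewrite -(@sum_bmultinom_msupp R n p N (fun m => mcoeff m p * \prod_i v i ^+ m i)).
    by apply: eq_bigr => m _; rewrite mcoeff_quotient_approx ?bmdeg.
  by move=> m ->; rewrite mul0r.
rewrite mevalE (bigID (fun m => (mdeg m < N)%N)) /= addrAC subrr add0r.
rewrite (le_trans (ler_norm_sum _ _ _))// mulr_suml.
rewrite [leRHS](bigID (fun m => (mdeg m < N)%N)) /=.
rewrite -[leLHS]add0r lerD ?sumr_ge0// => [m _|].
  by rewrite mulr_ge0 ?mulr_ge0 ?exprn_ge0 ?invr_ge0// ltW.
apply: ler_sum => m; rewrite -leqNgt => Nm.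
rewrite normrM -mulrA ler_wpM2l// (le_trans (norm_prod_le _ vr))//.
rewrite exprMn ler_wpM2l ?exprn_ge0 ?(ltW r0)//.
by apply: ler_wiXn2l => //; rewrite ?invr_ge0//; lra.
Qed.

Lemma quotient_series : exists2 r : R, 0 < r &
  (exists B : R, forall s, uniq s ->
     \sum_(m <- s) `|quotient_coef m| * r ^+ mdeg m <= B) /\
  forall v : 'I_n -> R, (forall i, `|v i| <= r / 2) ->
    (fun N => \sum_(m : bmultinom n N) quotient_coef m * \prod_i v i ^+ m i)
      @ \oo --> meval v f / meval v g.
Proof.
have [r /andP[r0 r1] ur] := quotient_radius; exists r => //.
have r0' := ltW r0.
pose B := `|b^-1| * (mnorm r f * 2).
have TB N : mnorm r (quotient_approx N) <= B by exact: mnorm_quotient_approx.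
split.
  (* This [N] exceeds every degree in [s], so the coefficients of [quotient_approx N] are already
     stationary there. *)
  exists B => s us; pose N := (\max_(m <- s) mdeg m).+1.
  apply: le_trans (TB N).
  apply: le_trans (sum_mcoeff_le_mnorm _ r0' us).
  rewrite big_seq [leRHS]big_seq; apply: ler_sum => m ms.
  by rewrite mcoeff_quotient_approx// ltnS leq_bigmax_seq.
move=> v vr.
have uv : `|meval v u| <= 2^-1.
  apply: le_trans ur; apply: norm_meval_le => i.
  by rewrite (le_trans (vr i))//; lra.
(* A zero of [g] would give u(v) = 1, against |u(v)| <= 1/2. *)
have gv : meval v g != 0.
  apply/eqP => gv; move: uv; rewrite mevalB meval1 mevalZ gv mulr0 subr0 normr1.
  by lra.
set l := meval v f / meval v g.
apply/cvgrPdist_le => e e0.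
(* The part with [|l|] dominates the geometric error, the part with [B] the tail. *)
have h0 : (fun N => (`|l| + B) * (2^-1 : R) ^+ N) @ \oo --> (0 : R).
  rewrite -[X in _ --> X](mulr0 (`|l| + B)); apply: cvgMr.
  by apply: cvg_expr; rewrite ger0_norm ?invr_ge0//; lra.
move/cvgrPdist_le : h0 => /(_ _ e0); apply: filterS => N.
rewrite sub0r normrN => hN.
apply: le_trans (le_trans (ler_norm _) hN).
rewrite -(subrKA (meval v (quotient_approx N))) (le_trans (ler_normD _ _))//.
rewrite mulrDl lerD//.
  rewrite quotient_approx_eval// -/l -[X in X - _]mulr1 -mulrBr opprB addrC subrK.
  by rewrite normrM ler_wpM2l// normrX lerXn2r ?nnegrE ?invr_ge0.
by rewrite (le_trans (quotient_tail _ r0 vr))// ler_wpM2r// exprn_ge0.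
Qed.

End QuotientSeries.

Definition translate (R : realType) (n : nat) (x : 'I_n -> R) (p : mpoly n R) :
  mpoly n R :=
  comp_mpoly (mktuple (fun i => mpolyX R (mnm1 i) + mpolyC n (x i))) p.

Lemma meval_translate (R : realType) (n : nat) (x h : 'I_n -> R) (p : mpoly n R) :
  meval h (translate x p) = meval (fun i => x i + h i) p.
Proof.
rewrite comp_mpoly_meval; apply: meval_eq => i.
by rewrite tnth_mktuple mevalD mevalXU mevalC addrC.
Qed.

(** Translation moves x to the origin, where g(x) becomes the nonzero constant term that
    [quotient_series] requires. *)
Lemma analytic_on_quotient (R : realType) (f g : mpoly 3 R) :
  analytic_on [set x | eval_at g x != 0] (fun x => eval_at f x / eval_at g x).
Proof.
move=> x /= gx.
pose tr := @translate R 3 (fun i => x 0 i).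
have trE p (h : 'rV_3) : meval (fun i => h 0 i) (tr p) = eval_at p (x + h).
  by rewrite meval_translate; apply: meval_eq => i; rewrite mxE.
have g0 : mcoeff mnm0 (tr g) != 0.
  rewrite -meval0_mcoeff0 meval_translate.
  by rewrite (@meval_eq _ _ _ (fun i => x 0 i))// => i; rewrite addr0.
have [r r0 [[B sumB] cv]] := quotient_series (tr f) g0.
exists (quotient_coef (tr f) (tr g)), (r / 2); split; first by rewrite divr_gt0.
move=> h hr.
have hi i : `|h 0 i| <= r / 2.
  apply: le_trans (ltW hr); rewrite [leRHS]/Num.Def.normr /= mx_normrE.
  exact: (le_bigmax _ (fun ij => `|h ij.1 ij.2|) (0, i)).
split; last by rewrite -!trE; exact: cv.
(* The total is the supremum of the finite sums of absolute values, all bounded by [B]. *)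
rewrite /summable (@le_lt_trans _ _ B%:E) ?ltry//.
apply: ge_ereal_sup => _ [A [finA _] <-].
rewrite fsbig_finite//= sumEFin lee_fin.
apply: le_trans (sumB _ (finmap.fset_uniq (fset_set A))).
apply: ler_sum => m _; rewrite normrM ler_wpM2l//.
apply: norm_prod_le => i; rewrite (le_trans (hi i))//; lra.
Qed.

(** * The first integral *)

Lemma continuous_eval_at (R : realType) (p : mpoly 3 R) :
  continuous (eval_at p : 'rV[R]_3 -> R).
Proof.
elim/mpoly_ring_ind : p => [c|i|q r hq hr|q r hq hr] x.
- have -> : eval_at (mpolyC 3 c) = cst c by apply/funext => y; exact: mevalC.
  exact: cst_continuous.
- have -> : eval_at (mpolyX R (mnm1 i)) = fun x : 'rV_3 => x 0 i
    by apply/funext => y; exact: mevalXU.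
  exact: coord_continuous.
- have -> : eval_at (q + r) = fun x : 'rV_3 => eval_at q x + eval_at r x
    by apply/funext => y; exact: mevalD.
  exact: continuousD (hq x) (hr x).
- have -> : eval_at (q * r) = fun x : 'rV_3 => eval_at q x * eval_at r x
    by apply/funext => y; exact: mevalM.
  exact: continuousM (hq x) (hr x).
Qed.

Lemma open_eval_at_neq0 (R : realType) (g : mpoly 3 R) :
  open [set x : 'rV[R]_3 | eval_at g x != 0].
Proof.
rewrite (_ : [set _ | _] = eval_at g @^-1` [set~ 0]).
  apply: open_comp => [x _|]; first exact: continuous_eval_at.
  by rewrite openC; exact: closed_eq.
by apply/seteqP; split=> x /= /eqP.
Qed.

Lemma eval_at_radius_poly (R : realType) (x : 'rV[R]_3) :
  eval_at (radius_poly R) x = x 0 0 ^+ 2 + x 0 1 ^+ 2.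
Proof. by rewrite /eval_at mevalD !rmorphXn /= !mevalXU. Qed.

Lemma eval_at_torus_poly (R : realType) (a : R) (x : 'rV[R]_3) :
  eval_at (torus_poly a) x =
  (x 0 0 ^+ 2 + x 0 1 ^+ 2 - a ^+ 2) ^+ 2 + x 0 2 ^+ 2 - 1.
Proof.
rewrite -eval_at_radius_poly /eval_at /torus_poly -/(radius_poly R).
by rewrite mevalB meval1 mevalD !rmorphXn /= mevalB rmorphXn /= mevalC mevalXU.
Qed.

Theorem proposition4p4 (R : realType) (a : R) (ha : 1 < a)
  (chi : vfield R) (hcubic : cubic chi) (hkol : kolmogorov chi)
  (htorus : on_torus a chi) :
  has_rational_first_integral chi.
Proof.
have [K hK] := htorus.
have radius2 x : eval_at (radius_poly R ^+ 2) x = eval_at (radius_poly R) x ^+ 2.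
  exact: rmorphXn.
exists (torus_poly a), (radius_poly R ^+ 2); split.
- exact: open_eval_at_neq0.
(* At (1,0,0) and (1,0,1) one has s = 1, so the quotient equals F, whose values there differ by 1
   because of z^2. *)
- exists (\row_i (i == 0)%:R), (\row_i (i != 1)%:R).
  split; rewrite /= ?radius2 ?eval_at_radius_poly ?eval_at_torus_poly !mxE /=;
    rewrite ?(expr1n, expr0n) /= ?addr0 ?divr1 ?expr1n ?oner_neq0//.
  by move/eqP; rewrite -subr_eq0 => /eqP; lra.
- exact: analytic_on_quotient.
- move=> I gamma _ itvI sol gU; apply: (quotient_constant_on_curves (K := K)) itvI sol gU.
  move=> x; rewrite radius2 expf_eq0 /= => x0.
  have cof := kolmogorov_cofactor ha hcubic hkol hK x0.
  split; first by rewrite hK; exact: mevalM.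
  (* By the cofactor identity, chi (s^2) = s (2 chi s) = K s^2 at x. *)
  rewrite derivationX2 /eval_at mevalM [X in X * _]mevalM rmorph_nat.
  rewrite expr2 mulrA -cof; ring.
Qed.
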